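(* Let $\mathcal{P}^i(x^i),\mathcal{P}^j(x^j)\subset\mathbb{R}^2$ be state-dependent polygons satisfying the standing assumptions listed in the context, and let $\phi^{k^i}_{l^j},\psi^{k^j}_{l^i},h_a,h_s:\mathbb{R}^{2n}\to\mathbb{R}$ and $\mathcal{S}=\{x:h_s(x)\ge0\}$ be as defined there. Then: 1) $h_a$ is smooth composed, i.e., for all $k^i,l^i\in[r^i]$ and $k^j,l^j\in[r^j]$, the functions $\phi^{k^i}_{l^j}$ and $\psi^{k^j}_{l^i}$ are smooth. Additionally, their gradients $\nabla\phi^{k^i}_{l^j}$ and $\nabla\psi^{k^j}_{l^i}$ (with respect to $x$) never vanish. 2) $h_a$ is a nonsmooth barrier function (NBF) candidate on the closed set $\mathcal{S}$.
   Context: Notation: $[r]=\{1,\dots,r\}$; $\|\cdot\|$ is the Euclidean norm. Polygons. Let $n\ge 2$. For $\mathfrak{i}\in\{i,j\}$ and $x^{\mathfrak i}\in\mathbb{R}^n$, let $\mathcal{P}^{\mathfrak i}(x^{\mathfrak i})\subset\mathbb{R}^2$ be a polygon with $r^{\mathfrak i}$ edges and $r^{\mathfrak i}$ vertices, given both as $\mathcal{P}^{\mathfrak i}(x^{\mathfrak i})=\{z\in\mathbb{R}^2:A^{\mathfrak i}(x^{\mathfrak i})z\le b^{\mathfrak i}(x^{\mathfrak i})\}=\bigcap_{k\in[r^{\mathfrak i}]}\{z\in\mathbb{R}^2:(A^{\mathfrak i}_k(x^{\mathfrak i}))^\top z\le b^{\mathfrak i}_k(x^{\mathfrak i})\}$,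 where $(A^{\mathfrak i}_k)^\top$ and $b^{\mathfrak i}_k$ are the $k$-th rows of $A^{\mathfrak i}(x^{\mathfrak i})\in\mathbb{R}^{r^{\mathfrak i}\times 2}$ and $b^{\mathfrak i}(x^{\mathfrak i})\in\mathbb{R}^{r^{\mathfrak i}}$, and as $\mathcal{P}^{\mathfrak i}(x^{\mathfrak i})=\operatorname{co}\{v^{\mathfrak i}_k(x^{\mathfrak i}):k\in[r^{\mathfrak i}]\}$ (convex hull), the $v^{\mathfrak i}_k(x^{\mathfrak i})\in\mathbb{R}^2$ being its vertices. Standing assumptions, for $\mathfrak{i}\in\{i,j\}$ and all $x^{\mathfrak i}\in\mathbb{R}^n$: $\mathcal{P}^{\mathfrak i}(x^{\mathfrak i})$ is convex, bounded, with non-empty interior; the functions $A^{\mathfrak i}(\cdot)$ and $b^{\mathfrak i}(\cdot)$ are continuously differentiable, and the set of inequalities $A^{\mathfrak i}(x^{\mathfrak i})z\le b^{\mathfrak i}(x^{\mathfrak i})$ contains no redundant inequality; $\|A^{\mathfrak i}_k(x^{\mathfrak i})\|=1$ for every $k\in[r^{\mathfrak i}]$; the functions $v^{\mathfrak i}_k:\mathbb{R}^n\to\mathbb{R}^2$ are continuously differentiable, and the Jacobian $\partial v^{\mathfrak i}_k/\partial x^{\mathfrak i}$ (a $2\times n$ matrix) always has full row rank. Write $x=[(x^i)^\top,(x^j)^\top]^\top\in\mathbb{R}^{2n}$. Functions. For $k^i,l^i\in[r^i]$, $k^j,l^j\in[r^j]$: $$\phi^{k^i}_{l^j}(x)=(A^i_{k^i}(x^i))^\top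 v^j_{l^j}(x^j)-b^i_{k^i}(x^i),\qquad \psi^{k^j}_{l^i}(x)=(A^j_{k^j}(x^j))^\top v^i_{l^i}(x^i)-b^j_{k^j}(x^j),$$ $$h_a(x)=\max\Big\{\max_{k^i\in[r^i]}\min_{l^j\in[r^j]}\phi^{k^i}_{l^j}(x),\ \max_{k^j\in[r^j]}\min_{l^i\in[r^i]}\psi^{k^j}_{l^i}(x)\Big\},$$ so $h_a$ is a Boolean (max/min) composition of the component functions $\phi^{k^i}_{l^j},\psi^{k^j}_{l^i}$. Safe set. For convex sets $\mathcal{A},\mathcal{B}\subset\mathbb{R}^2$ the signed distance is $\operatorname{sd}(\mathcal{A},\mathcal{B})=\inf_t\{\|t\|:(\mathcal{A}+t)\cap\mathcal{B}\ne\emptyset\}-\inf_t\{\|t\|:(\mathcal{A}+t)\cap\mathcal{B}=\emptyset\}$. Set $h_s(x)=\operatorname{sd}(\mathcal{P}^i(x^i),\mathcal{P}^j(x^j))$ and $\mathcal{S}=\{x\in\mathbb{R}^{2n}:h_s(x)\ge0\}$. Definition. Given a nonempty closed set $\mathcal{C}\subset\mathbb{R}^{m}$ with no isolated point, a locally Lipschitz continuous function $h:\mathbb{R}^m\to\mathbb{R}$ is called a nonsmooth barrier function (NBF) candidate on $\mathcal{C}$ if $h(x)=0$ for all $x\in\partial\mathcal{C}$, $h(x)>0$ for all $x\in\operatorname{Int}(\mathcal{C})$, and $h(x)<0$ for all $x\in\mathbb{R}^m\setminus\mathcal{C}$.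
   Formalization: ''Smooth'' means continuously differentiable. S may be empty or have isolated points, where ''NBF candidate'' is undefined; full candidacy is stated when S is nonempty without isolated points, while closedness, local Lipschitz continuity and the sign conditions are proved always. *)

(* Defs.v *)
From HB Require Import structures.
From mathcomp Require Import all_boot all_order all_algebra.
From mathcomp Require Import all_classical all_reals all_analysis.

Set Implicit Arguments.
Unset Strict Implicit.
Unset Printing Implicit Defensive.

Import Order.TTheory GRing.Theory Num.Theory.
Import numFieldNormedType.Exports.

Local Open Scope classical_set_scope.
Local Open Scope ring_scope.

(* Points of R^m are row vectors 'rV[R]_m. The library
   norm `|_| on them is the sup norm; it is used only for topological notions
   (continuity, differentiability, boundedness, the local Lipschitz property),
   which do not depend on the choice of a norm on R^m. Lengths are measured
   with the Euclidean norm below. *)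

Section Euclidean.
Context {R : realType}.

Definition dotp m (u w : 'rV[R]_m) : R := \sum_(j < m) u 0 j * w 0 j.

Definition enorm m (u : 'rV[R]_m) : R := Num.sqrt (\sum_(j < m) u 0 j ^+ 2).

Definition gradient m (f : 'rV[R]_m -> R) (x : 'rV[R]_m) : 'rV[R]_m :=
  \row_(j < m) 'D_(delta_mx 0 j) f x.

(* The domain being finite dimensional, the second clause is the continuity of
   the derivative for the operator norm. *)
Definition cont_differentiable m (W : normedModType R) (f : 'rV[R]_m -> W) :
    Prop :=
  (forall x, differentiable f x) /\
  (forall u, continuous (fun x => 'd f x u)).

(* The library's 'J acts on row vectors on the right, hence the transpose. *)
Definition jac m p (f : 'rV[R]_m -> 'rV[R]_p) (x : 'rV[R]_m) : 'M[R]_(p, m) :=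
  ('J f x)^T.

(* The default values of the iterated operators are themselves values of f. *)
Definition fmax r (f : 'I_r.+1 -> R) : R := \big[Num.max/f ord0]_(k < r.+1) f k.
Definition fmin r (f : 'I_r.+1 -> R) : R := \big[Num.min/f ord0]_(k < r.+1) f k.

End Euclidean.

Section Polygons.
Context {R : realType}.

Definition polyhedron r (A : 'M[R]_(r, 2)) (b : 'cV[R]_r) : set 'rV[R]_2 :=
  [set z | forall k, dotp (row k A) z <= b k 0].

Definition conv_hull r (v : 'I_r -> 'rV[R]_2) : set 'rV[R]_2 :=
  [set z | exists w : 'I_r -> R,
     [/\ forall k, 0 <= w k, \sum_(k < r) w k = 1 &
         z = \sum_(k < r) w k *: v k]].

Definition vertex (P : set 'rV[R]_2) (p : 'rV[R]_2) : Prop :=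
  P p /\ forall y z (t : R), P y -> P z -> 0 < t < 1 ->
    p = t *: y + (1 - t) *: z -> y = z.

Definition redundant r (A : 'M[R]_(r, 2)) (b : 'cV[R]_r) (k : 'I_r) : Prop :=
  [set z | forall l, l != k -> dotp (row l A) z <= b l 0] = polyhedron A b.

(* State-dependent polygon with r.+1 edges and r.+1 vertices (a positive number,
   so that maxima and minima over edges or vertices make sense). *)
Record polygon_assumptions n r (A : 'rV[R]_n -> 'M[R]_(r.+1, 2))
    (b : 'rV[R]_n -> 'cV[R]_(r.+1)) (v : 'I_r.+1 -> 'rV[R]_n -> 'rV[R]_2) :
    Prop := PolygonAssumptions {
  polygon_hull : forall x, polyhedron (A x) (b x) = conv_hull (v ^~ x) ;
  polygon_vertex : forall x k, vertex (polyhedron (A x) (b x)) (v k x) ;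
  polygon_vertex_inj : forall x, injective (v ^~ x) ;
  polygon_convex : forall x, convex_set (polyhedron (A x) (b x)) ;
  polygon_bounded : forall x, bounded_set (polyhedron (A x) (b x)) ;
  polygon_interior : forall x, (polyhedron (A x) (b x))° !=set0 ;
  polygon_A_C1 : cont_differentiable A ;
  polygon_b_C1 : cont_differentiable b ;
  polygon_irredundant : forall x k, ~ redundant (A x) (b x) k ;
  polygon_unit : forall x k, enorm (row k (A x)) = 1 ;
  polygon_v_C1 : forall k, cont_differentiable (v k) ;
  polygon_v_rank : forall k x, row_free (jac (v k) x)
}.

Definition sdist (P Q : set 'rV[R]_2) : R :=
  inf [set enorm t | t in [set t | [set z + t | z in P] `&` Q !=set0]] -
  inf [set enorm t | t in [set t | [set z + t | z in P] `&` Q = set0]].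

End Polygons.

Section PairOfPolygons.
Context {R : realType} {n ri rj : nat}.
Variables (Ai : 'rV[R]_n -> 'M[R]_(ri.+1, 2)) (bi : 'rV[R]_n -> 'cV[R]_(ri.+1))
  (vi : 'I_ri.+1 -> 'rV[R]_n -> 'rV[R]_2)
  (Aj : 'rV[R]_n -> 'M[R]_(rj.+1, 2)) (bj : 'rV[R]_n -> 'cV[R]_(rj.+1))
  (vj : 'I_rj.+1 -> 'rV[R]_n -> 'rV[R]_2).

(* A state x of the pair is row_mx x^i x^j. *)
Definition phi (k : 'I_ri.+1) (l : 'I_rj.+1) (x : 'rV[R]_(n + n)) : R :=
  dotp (row k (Ai (lsubmx x))) (vj l (rsubmx x)) - bi (lsubmx x) k 0.

Definition psi (k : 'I_rj.+1) (l : 'I_ri.+1) (x : 'rV[R]_(n + n)) : R :=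
  dotp (row k (Aj (rsubmx x))) (vi l (lsubmx x)) - bj (rsubmx x) k 0.

Definition h_a (x : 'rV[R]_(n + n)) : R :=
  Num.max (fmax (fun k => fmin (fun l => phi k l x)))
          (fmax (fun k => fmin (fun l => psi k l x))).

Definition h_s (x : 'rV[R]_(n + n)) : R :=
  sdist (polyhedron (Ai (lsubmx x)) (bi (lsubmx x)))
        (polyhedron (Aj (rsubmx x)) (bj (rsubmx x))).

Definition safe_set : set 'rV[R]_(n + n) := [set x | 0 <= h_s x].

End PairOfPolygons.

Section NonsmoothBarrier.
Context {R : realType}.

Definition boundary m (C : set 'rV[R]_m) : set 'rV[R]_m :=
  closure C `\` C°.

Definition locally_lipschitz m (h : 'rV[R]_m -> R) : Prop :=
  forall x : 'rV[R]_m, exists2 U : set 'rV[R]_m, nbhs x U & [lipschitz h y | y in U].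

Definition nbf_conditions m (C : set 'rV[R]_m) (h : 'rV[R]_m -> R) : Prop :=
  [/\ locally_lipschitz h,
      forall x, boundary C x -> h x = 0,
      forall x, C° x -> 0 < h x &
      forall x, ~ C x -> h x < 0].

(* The notion is only defined for a set C satisfying the first three clauses;
   nbf_conditions is what it then requires of h. For C = safe_set, polygon_assumptions
   imply that C is closed, but neither that it is nonempty (two large polygons
   moving only a little may always overlap) nor that it has no isolated point
   (the ends of two facing edges may move in opposite directions). *)
Definition nbf_candidate m (C : set 'rV[R]_m) (h : 'rV[R]_m -> R) : Prop :=
  [/\ C !=set0, closed C, isolated C = set0 & nbf_conditions C h].

End NonsmoothBarrier.

(* Main.v *)
(* In the plane, disjoint polygons are separated by an edge of one of them: by
   Helly's theorem three of the edge half-planes already have empty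
   intersection, two of them belong to the same polygon, and the edge line of
   the third one separates. If no edge line separates, even weakly, this remains
   so after every small translation, hence the polygons overlap and [h_s < 0];
   if some edge line separates weakly, an arbitrarily small translation along
   its normal makes the polygons disjoint. So [h_s >= 0] iff [h_a >= 0].
   If [h_a x = 0], the polygons meet inside an edge line, so a vertex of one
   lies in the other. Its Jacobian being surjective, this vertex can be moved
   towards an interior point of the other polygon, which makes [h_a] negative
   arbitrarily close to [x]; hence [h_a > 0] on the interior of the safe set. *)

Require Import Defs.
From HB Require Import structures.
From mathcomp Require Import all_boot all_order all_algebra.
From mathcomp Require Import all_classical all_reals all_analysis.
From mathcomp Require Import ring lra.

Set Implicit Arguments.
Unset Strict Implicit.
Unset Printing Implicit Defensive.

Import Order.TTheory GRing.Theory Num.Theory.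
Import numFieldNormedType.Exports.

Local Open Scope classical_set_scope.
Local Open Scope ring_scope.

(** * Helly's theorem in the plane, by way of Radon partitions *)

Section Helly.
Context {R : realType}.
Implicit Types (p : nat).

(** Convexity for finite families of any size. Membership is asked only at positive weights, so both
    halves of a Radon partition can be written as sums over the whole index type. *)
Definition convex_closed p (C : set 'rV[R]_p) : Prop :=
  forall (I : finType) (w : I -> R) (q : I -> 'rV[R]_p),
    (forall i, 0 <= w i) -> \sum_i w i = 1 ->
    (forall i, 0 < w i -> C (q i)) -> C (\sum_i w i *: q i).

Lemma convex_closedI p (C D : set 'rV[R]_p) :
  convex_closed C -> convex_closed D -> convex_closed (C `&` D).
Proof.
move=> cC cD I w q w0 w1 CDq; split.
- by apply: cC => // i /CDq[].
- by apply: cD => // i /CDq[].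
Qed.

(** With a coordinate 1 appended to each point, an affine dependence becomes a linear one, and more
    than [p + 1] rows of length [p + 1] are linearly dependent. *)
Lemma affine_dependence p (I : finType) (q : I -> 'rV[R]_p) :
  (p.+1 < #|I|)%N -> exists c : I -> R,
    [/\ exists i, c i != 0, \sum_i c i = 0 & \sum_i c i *: q i = 0].
Proof.
move=> pI; pose M : 'M[R]_(#|I|, p + 1) :=
  \matrix_k row_mx (q (enum_val k)) (const_mx 1).
have /rowV0Pn[v /sub_kermxP vM v0] : kermx M != 0.
  rewrite kermx_eq0 -row_leq_rank -ltnNge; apply: leq_ltn_trans pI.
  by rewrite (leq_trans (rank_leq_col _)) // addn1.
exists (fun i => v 0 (enum_rank i)).
have vME : \sum_i v 0 (enum_rank i) *: row_mx (q i) (const_mx 1 : 'rV_1) = 0.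
  rewrite -[RHS]vM mulmx_sum_row (reindex (@enum_val I predT)) /=; last first.
    by apply: onW_bij; apply: enum_val_bij.
  by apply: eq_bigr => k _; rewrite rowK enum_valK.
split.
- have [k vk] : exists k, v 0 k != 0.
    apply/existsP; apply: contraR v0 => /existsPn v0; apply/eqP/rowP => k.
    by rewrite mxE; apply/eqP/negPn.
  by exists (enum_val k); rewrite enum_valK.
- have := congr1 (fun u : 'rV_(p + 1) => u 0 (rshift p 0)) vME.
  rewrite summxE mxE (eq_bigr (fun i => v 0 (enum_rank i))) // => i _.
  by rewrite mxE row_mxEr mxE mulr1.
- apply/rowP => j; rewrite summxE mxE.
  have := congr1 (fun u : 'rV_(p + 1) => u 0 (lshift 1 j)) vME.
  rewrite summxE mxE => sum0; rewrite -[RHS]sum0; apply: eq_bigr => i _.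
  by rewrite [in RHS]mxE row_mxEl mxE.
Qed.

(* Radon's partition of the points [q i] by the sign of an affine dependence. *)
Lemma helly_radon p (I : finType) (C : I -> set 'rV[R]_p) :
  (p.+1 < #|I|)%N -> (forall i, convex_closed (C i)) ->
  (forall i, exists z, forall j, j != i -> C j z) ->
  exists z, forall i, C i z.
Proof.
move=> pI cC /choice[q Cq].
have [c [[i0 ci0] c0 cq0]] := affine_dependence q pI.
pose P i := Num.max 0 (c i); pose N i := Num.max 0 (- c i).
have P0 i : 0 <= P i by rewrite le_max lexx.
have N0 i : 0 <= N i by rewrite le_max lexx.
have PN i : c i = P i - N i.
  rewrite /P /N; case: (ltgtP (c i) 0) => h;
    by rewrite /Num.max; do !case: ifP => ?; lra.
have PorN i : 0 < P i -> 0 < N i -> False.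
  rewrite /P /N !lt_max !ltxx /= oppr_gt0 => /ltW /le_lt_trans h /h.
  by rewrite ltxx.
pose S := \sum_i P i.
have SN : S = \sum_i N i.
  apply/eqP; rewrite -subr_eq0 -sumrB -[X in _ == X]c0.
  by apply/eqP/eq_bigr => i _; rewrite PN.
have S0 : 0 < S.
  rewrite lt_def (sumr_ge0 _ (fun i _ => P0 i)) andbT; apply/negP => /eqP S0.
  have /(_ i0 isT)/eqP Pi0 := psumr_eq0P (fun i _ => P0 i) S0.
  have /(_ i0 isT)/eqP Ni0 := psumr_eq0P (fun i _ => N0 i) (etrans (esym SN) S0).
  by move: ci0; rewrite PN (eqP Pi0) (eqP Ni0) subrr eqxx.
(* The positive and negative parts of [c] have the same mass [S] and the same weighted sum of
   points, so after normalisation they share one barycentre. *)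
have zE : \sum_i (P i / S) *: q i = \sum_i (N i / S) *: q i.
  apply/eqP; rewrite -subr_eq0 -sumrB.
  rewrite (eq_bigr (fun i => S^-1 *: (c i *: q i))); last first.
    by move=> i _; rewrite -scalerBl scalerA -mulrBl -PN mulrC.
  by rewrite -scaler_sumr cq0 scaler0.
exists (\sum_i (P i / S) *: q i) => j.
(* The barycentre is written with the part of the dependence that gives [j] weight zero: the points
   [q i] it involves all lie in [C j]. *)
have [Pj|Pj] := ltP 0 (P j).
  rewrite zE; apply: cC => [i||i]; rewrite ?divr_ge0 ?(ltW S0)//.
    by rewrite -mulr_suml -SN divff ?gt_eqF.
  rewrite pmulr_lgt0 ?invr_gt0// => Ni; apply: Cq.
  by apply: contraPneq Ni => <- /PorN; apply.
apply: cC => [i||i]; rewrite ?divr_ge0 ?(ltW S0)//.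
  by rewrite -mulr_suml divff ?gt_eqF.
rewrite pmulr_lgt0 ?invr_gt0// => Pi; apply: Cq.
by apply: contraTneq Pj => ->; rewrite -ltNge.
Qed.

(* The sets [C i `&` C j], for a fixed [i], meet three by three by the case of
   four sets. *)
Lemma helly_plane (I : Type) (C : I -> set 'rV[R]_2) (s : seq I) :
  (forall i, convex_closed (C i)) ->
  (forall i j k, C i `&` C j `&` C k !=set0) ->
  exists z, forall i, List.In i s -> C i z.
Proof.
elim: s C => [|i s IHs] C cC C3; first by exists 0.
have [|i0 j k|z Cz] := IHs (fun j => C i `&` C j).
- by move=> j; apply: convex_closedI.
- have [|||z Cz] := @helly_radon 2 'I_4
      (fun m => nth (C i) [:: C i; C i0; C j; C k] m).
  + by rewrite card_ord.
  + by case=> [[|[|[|[|m]]]] ?] /=.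
  (* The default [setT] makes the claim trivial beyond index 3, so [l] may range over all natural
     numbers. *)
  + move=> m; have [z Cz] : exists z, forall l, l != (m : nat) ->
        nth setT [:: C i; C i0; C j; C k] l z.
      case: m => [[|[|[|[|m]]]] hm] //=.
      * have [z [[? ?] ?]] := C3 i0 j k.
        by exists z => -[|[|[|[|l]]]] //=; rewrite nth_nil.
      * have [z [[? ?] ?]] := C3 i j k.
        by exists z => -[|[|[|[|l]]]] //=; rewrite nth_nil.
      * have [z [[? ?] ?]] := C3 i i0 k.
        by exists z => -[|[|[|[|l]]]] //=; rewrite nth_nil.
      * have [z [[? ?] ?]] := C3 i i0 j.
        by exists z => -[|[|[|[|l]]]] //=; rewrite nth_nil.
    exists z => l lm; have := Cz _ lm.
    by rewrite (set_nth_default (C i)) //= ltn_ord.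
  have := (Cz (@Ordinal 4 0 isT), Cz (@Ordinal 4 1 isT),
          Cz (@Ordinal 4 2 isT), Cz (@Ordinal 4 3 isT)).
  by case=> -[[/= ? ?] ? ?]; exists z.
(* The point found lies in [C i] only by way of some [j] in the tail, so an empty tail needs its own
   point. *)
case: s IHs Cz => [|j s] _ Cz.
  by have [z' [[? ?] ?]] := C3 i i i; exists z' => ? [<-|].
exists z => k [<-|ks]; first by have [] := Cz j (or_introl erefl).
by have [] := Cz _ ks.
Qed.
End Helly.

(** * Scalar product and Euclidean length *)

Section Dotp.
Context {R : realType} (m : nat).
Implicit Types (u v w : 'rV[R]_m) (c : R).

Lemma dotpDr u v w : dotp u (v + w) = dotp u v + dotp u w.
Proof. by rewrite -big_split; apply: eq_bigr => j _; rewrite mxE mulrDr. Qed.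

Lemma dotpZr c u v : dotp u (c *: v) = c * dotp u v.
Proof. by rewrite mulr_sumr; apply: eq_bigr => j _; rewrite mxE mulrCA. Qed.

Lemma dotpNr u v : dotp u (- v) = - dotp u v.
Proof. by rewrite -scaleN1r dotpZr mulN1r. Qed.

Lemma dotpNl u v : dotp (- u) v = - dotp u v.
Proof. by rewrite -sumrN; apply: eq_bigr => j _; rewrite mxE mulNr. Qed.

Lemma dotpBr u v w : dotp u (v - w) = dotp u v - dotp u w.
Proof. by rewrite dotpDr dotpNr. Qed.

Lemma dotp_sumr (I : finType) (c : I -> R) (v : I -> 'rV[R]_m) u :
  dotp u (\sum_i c i *: v i) = \sum_i c i * dotp u (v i).
Proof.
rewrite /dotp; under eq_bigr do rewrite summxE mulr_sumr.
rewrite exchange_big; apply: eq_bigr => i _; rewrite mulr_sumr.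
by apply: eq_bigr => j _; rewrite mxE mulrCA.
Qed.

Lemma dotp_continuous u : continuous (dotp u).
Proof.
apply: continuous_big => [|j _ v]; first exact: add_continuous.
by apply: (@cvgMl_tmp _ _ (nbhs v)); apply: coord_continuous.
Qed.

Lemma enorm_ge0 u : 0 <= enorm u.
Proof. exact: sqrtr_ge0. Qed.

Lemma dotp_enorm u : enorm u = 1 -> dotp u u = 1.
Proof.
move=> u1; have /sqr_sqrtr : 0 <= \sum_(j < m) u 0 j ^+ 2.
  by apply: sumr_ge0 => j _; apply: sqr_ge0.
rewrite -/(enorm u) u1 expr1n => ->.
by apply: eq_bigr => j _; rewrite expr2.
Qed.

Lemma enormZ c u : enorm u = 1 -> enorm (c *: u) = `|c|.
Proof.
move=> u1; rewrite /enorm; under eq_bigr do rewrite mxE exprMn.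
by rewrite -mulr_sumr sqrtrM ?sqr_ge0 // sqrtr_sqr -/(enorm u) u1 mulr1.
Qed.

End Dotp.

(** * Planar polygons: separation by edge lines, signed distance, touching positions *)

Section Polytopes.
Context {R : realType}.
Implicit Types (r s : nat) (a q z t : 'rV[R]_2).

(** Cauchy-Schwarz, from Lagrange's identity: in the plane the defect is the square of a
    determinant. *)
Lemma dotp_le_enorm a t : enorm a = 1 -> dotp a t <= enorm t.
Proof.
move=> /dotp_enorm; rewrite /enorm /dotp !big_ord_recl !big_ord0 !addr0 => a1.
rewrite (le_trans (ler_norm _)) // -sqrtr_sqr ler_sqrt; last first.
  by rewrite addr_ge0 ?sqr_ge0.
rewrite -subr_ge0 -[X in X - _]mul1r -a1.
set a0 := a 0 ord0; set a2 := a 0 _; set t0 := t 0 ord0; set t2 := t 0 _.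
suff -> : (a0 * a0 + a2 * a2) * (t0 ^+ 2 + t2 ^+ 2) -
    (a0 * t0 + a2 * t2) ^+ 2 = (a0 * t2 - a2 * t0) ^+ 2 by apply: sqr_ge0.
ring.
Qed.

(** Weak separation by an edge line. Testing the vertices [w] of the other polygon suffices, since a
    half-plane containing them contains their hull. *)
Definition separates r s (A : 'M[R]_(r, 2)) (b : 'cV[R]_r)
    (w : 'I_s -> 'rV[R]_2) : Prop :=
  exists k, forall l, b k 0 <= dotp (row k A) (w l).

Lemma separatesPn r s (A : 'M[R]_(r, 2)) b (w : 'I_s -> 'rV[R]_2) :
  ~ separates A b w <-> forall k, exists l, dotp (row k A) (w l) < b k 0.
Proof.
split=> [nsep k|h [k sep]].
  apply: contrapT => /forallNP nl; apply: nsep.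
  by exists k => l; rewrite leNgt; apply/negP.
by have [l] := h k; rewrite ltNge sep.
Qed.

(** A polygon frozen at one state, for the geometric arguments in which the state does not vary. *)
Record polytope r (A : 'M[R]_(r.+1, 2)) (b : 'cV[R]_r.+1)
    (v : 'I_r.+1 -> 'rV[R]_2) : Prop := Polytope {
  polytope_hull : polyhedron A b = conv_hull v ;
  polytope_bounded : bounded_set (polyhedron A b) ;
  polytope_interior : (polyhedron A b)° !=set0 ;
  polytope_unit : forall k, enorm (row k A) = 1
}.

Lemma hull_vertex r (v : 'I_r -> 'rV[R]_2) k : conv_hull v (v k).
Proof.
exists (fun l => (l == k)%:R); split=> [l||]; first by rewrite ler0n.
  by rewrite (bigD1 k) //= eqxx big1 ?addr0 // => l /negPf ->.
rewrite (bigD1 k) //= eqxx big1 ?addr0 ?scale1r // => l /negPf ->.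
by rewrite scale0r.
Qed.

Lemma average_ge (I : finType) (w f : I -> R) c :
  (forall i, 0 <= w i) -> \sum_i w i = 1 -> (forall i, 0 < w i -> c <= f i) ->
  c <= \sum_i w i * f i.
Proof.
move=> w0 w1 cf; rewrite -[c]mul1r -w1 mulr_suml; apply: ler_sum => i _.
have := w0 i; rewrite le_eqVlt => /predU1P[<-|wi]; first by rewrite !mul0r.
by rewrite ler_pM2l // cf.
Qed.

Lemma average_le (I : finType) (w f : I -> R) c :
  (forall i, 0 <= w i) -> \sum_i w i = 1 -> (forall i, 0 < w i -> f i <= c) ->
  \sum_i w i * f i <= c.
Proof.
move=> w0 w1 fc; rewrite -lerN2 -sumrN.
under eq_bigr do rewrite -mulrN.
by apply: average_ge => // i /fc; rewrite lerN2.
Qed.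

Lemma hull_ge r (v : 'I_r -> 'rV[R]_2) a c z :
  (forall l, c <= dotp a (v l)) -> conv_hull v z -> c <= dotp a z.
Proof.
by move=> cv [w [w0 w1 ->]]; rewrite dotp_sumr; apply: average_ge.
Qed.

Lemma halfplane_convex_closed a c :
  convex_closed [set z | dotp a z <= c].
Proof.
by move=> I w q w0 w1 qc; rewrite /= dotp_sumr; apply: average_le.
Qed.

(** Helly's theorem for the half-planes of all edges of both polygons; it reduces meeting to
    conditions on one edge at a time. *)
Lemma polyhedra_meet r s (A : 'M[R]_(r, 2)) b (A' : 'M[R]_(s, 2)) b' :
  polyhedron A b !=set0 -> polyhedron A' b' !=set0 ->
  (forall k, exists2 z, polyhedron A' b' z & dotp (row k A) z <= b k 0) ->
  (forall k, exists2 z, polyhedron A b z & dotp (row k A') z <= b' k 0) ->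
  polyhedron A b `&` polyhedron A' b' !=set0.
Proof.
move=> [z0 Pz0] [z1 Qz1] hk hk'.
pose C (i : 'I_r + 'I_s) : set 'rV[R]_2 := match i with
  | inl k => [set z | dotp (row k A) z <= b k 0]
  | inr k => [set z | dotp (row k A') z <= b' k 0] end.
(* Among three edges at least two belong to the same polygon, which supplies
   the common point. *)
have [||z Cz] := @helly_plane R _ C (enum {: 'I_r + 'I_s}).
- by case=> k; apply: halfplane_convex_closed.
- move=> [k1|k1] [k2|k2] [k3|k3]; rewrite /C /=.
  + by exists z0; do !split; apply: Pz0.
  + by have [z Pz ?] := hk' k3; exists z; do !split => //; apply: Pz.
  + by have [z Pz ?] := hk' k2; exists z; do !split => //; apply: Pz.
  + by have [z Pz ?] := hk k1; exists z; do !split => //; apply: Pz.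
  + by have [z Pz ?] := hk' k1; exists z; do !split => //; apply: Pz.
  + by have [z Pz ?] := hk k2; exists z; do !split => //; apply: Pz.
  + by have [z Pz ?] := hk k3; exists z; do !split => //; apply: Pz.
  + by exists z1; do !split; apply: Qz1.
have In_enum i : List.In i (enum {: 'I_r + 'I_s}).
  have : i \in enum {: 'I_r + 'I_s} by rewrite mem_enum.
  by elim: (enum _) => //= j e IHe; rewrite inE => /predU1P[->|/IHe]; [left|right].
exists z; split=> k; first exact: (Cz (inl k) (In_enum _)).
exact: (Cz (inr k) (In_enum _)).
Qed.

Lemma finite_pos_lb (I : finType) (f : I -> R) :
  (forall i, 0 < f i) -> exists2 e, 0 < e & forall i, e <= f i.
Proof.
move=> f0; exists (\big[Num.min/1]_i f i); first exact: lt_bigmin.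
by move=> i; apply: bigmin_le.
Qed.

Lemma sdist_ge0 (P Q : set 'rV[R]_2) :
  (forall e, 0 < e ->
    exists2 t, enorm t <= e & [set z + t | z in P] `&` Q = set0) ->
  0 <= sdist P Q.
Proof.
move=> h; rewrite subr_ge0; apply: (@le_trans _ _ 0).
  apply/ler_addgt0Pr => e /h[t te tPQ]; rewrite add0r; apply: le_trans te.
  by apply: ge_inf; [exists 0 => _ [? _ <-]; apply: enorm_ge0|exists t].
set D := [set enorm t | t in [set t | [set z + t | z in P] `&` Q !=set0]].
(* If no translate meets [Q], the first infimum is that of the empty set, whose value is 0. *)
have [->|/set0P D0] := eqVneq D set0.
  by rewrite inf0.
by apply: lb_le_inf => // _ [? _ <-]; apply: enorm_ge0.
Qed.

(** The zero translation bounds the first infimum by 0, and the second is at least [e]. The last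
    hypothesis keeps the second set nonempty, the infimum of the empty set being 0. *)
Lemma sdist_lt0 (P Q : set 'rV[R]_2) e : 0 < e ->
  (forall t, enorm t < e -> [set z + t | z in P] `&` Q !=set0) ->
  (exists t, [set z + t | z in P] `&` Q = set0) ->
  sdist P Q < 0.
Proof.
move=> e0 meet [t tPQ]; rewrite subr_lt0; apply: (@le_lt_trans _ _ 0).
  have E0 : @enorm R 2 0 = 0.
    by rewrite /enorm big1 ?sqrtr0 // => j _; rewrite mxE expr0n.
  apply: ge_inf; first by exists 0 => _ [? _ <-]; apply: enorm_ge0.
  by exists 0 => //=; apply: meet; rewrite E0.
apply: lt_le_trans e0 _; apply: lb_le_inf; first by exists (enorm t), t.
move=> _ [u uPQ <-]; rewrite leNgt; apply/negP => /meet.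
by rewrite uPQ => -[].
Qed.

Lemma bounded_disjoint_translate (P Q : set 'rV[R]_2) :
  bounded_set P -> bounded_set Q -> exists t, [set z + t | z in P] `&` Q = set0.
Proof.
move=> [M [_ PM]] [N [_ QN]].
have coord (z : 'rV[R]_2) : `|z 0 0| <= `|z|.
  by rewrite [leRHS]/Num.norm /= mx_normrE; apply: (le_bigmax _ _ (0, 0)).
(* First coordinates are at least [- (M + 1)] on [P] and at most [N + 1] on [Q], so this shift puts
   [P] beyond [Q]. The bounds hold only strictly above [M] and [N], hence the added units. *)
exists (const_mx (N + 1 + (M + 1) + 1)); rewrite -subset0 => _ [[z Pz <-]] Qz.
have := PM (M + 1); rewrite ltrDl ltr01 => /(_ isT _ Pz)/(le_trans (coord _)).
have := QN (N + 1); rewrite ltrDl ltr01 => /(_ isT _ Qz)/(le_trans (coord _)).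
rewrite !mxE !ler_norml => /andP[_ +] /andP[+ _].
lra.
Qed.

Lemma polytope_vertex r (A : 'M[R]_(r.+1, 2)) b v k :
  polytope A b v -> polyhedron A b (v k).
Proof. by case=> -> *; apply: hull_vertex. Qed.

Lemma polytope_ge r (A : 'M[R]_(r.+1, 2)) b v a c z : polytope A b v ->
  (forall l, c <= dotp a (v l)) -> polyhedron A b z -> c <= dotp a z.
Proof. by case=> -> *; apply: hull_ge. Qed.

Lemma sdist_ge0P r s (A : 'M[R]_(r.+1, 2)) b v (A' : 'M[R]_(s.+1, 2)) b' v' :
  polytope A b v -> polytope A' b' v' ->
  0 <= sdist (polyhedron A b) (polyhedron A' b') <->
  separates A b v' \/ separates A' b' v.
Proof.
move=> Pv Pv'; split; last first.
  move=> sep; apply: sdist_ge0 => e e0; case: sep => -[k sep].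
    (* The first polygon retreats by [e] from its own edge line, against the outward normal. *)
    exists (- e *: row k A).
      by rewrite enormZ ?(polytope_unit Pv) // normrN gtr0_norm.
    rewrite -subset0 => _ [[z Pz <-]] /(polytope_ge Pv' sep).
    rewrite dotpDr dotpZr (dotp_enorm (polytope_unit Pv k)).
    by have := Pz k; lra.
  (* The edge now belongs to the second polygon, and the first moves away along its outward
     normal. *)
  exists (e *: row k A').
    by rewrite enormZ ?(polytope_unit Pv') // gtr0_norm.
  rewrite -subset0 => _ [[z /(polytope_ge Pv sep) bz <-]] /(_ k).
  by rewrite dotpDr dotpZr (dotp_enorm (polytope_unit Pv' k)); lra.
move=> sd0; apply: contrapT.
move=> /not_orP[/separatesPn/choice[f fP] /separatesPn/choice[g gP]].
(* Finitely many strict inequalities share a positive slack, which by Cauchy-Schwarz no shorter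
   translation can use up. *)
have [e1 e10 e1P] : exists2 e, 0 < e & forall k,
    e <= b k 0 - dotp (row k A) (v' (f k)).
  by apply: finite_pos_lb => k; rewrite subr_gt0.
have [e2 e20 e2P] : exists2 e, 0 < e & forall k,
    e <= b' k 0 - dotp (row k A') (v (g k)).
  by apply: finite_pos_lb => k; rewrite subr_gt0.
move: sd0; rewrite leNgt => /negP; apply.
apply: (@sdist_lt0 _ _ (Num.min e1 e2)); first by rewrite lt_min e10.
  move=> t; rewrite lt_min => /andP[te1 te2].
  (* Translating a polygon by [t] keeps its normals and changes its offsets from [b] to [c]. *)
  pose c := b + \col_k dotp (row k A) t.
  have shift z : polyhedron A b z -> polyhedron A c (z + t).
    by move=> Pz k; rewrite !mxE dotpDr lerD2r.
  have [] := @polyhedra_meet _ _ A c A' b'.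
  - by exists (v ord0 + t); apply: shift; apply: polytope_vertex.
  - by exists (v' ord0); apply: polytope_vertex.
  - move=> k; exists (v' (f k)); first exact: polytope_vertex.
    have := e1P k; have := dotp_le_enorm (- t) (polytope_unit Pv k).
    rewrite !mxE dotpNr; have : enorm (- t) = enorm t.
      by rewrite /enorm; under eq_bigr do rewrite mxE sqrrN.
    by move=> ->; lra.
  - move=> k; exists (v (g k) + t); first by apply: shift; apply: polytope_vertex.
    have := e2P k; have := dotp_le_enorm t (polytope_unit Pv' k).
    by rewrite dotpDr; lra.
  move=> z [Pz Qz]; exists z; split=> //; exists (z - t); last by rewrite subrK.
  by move=> k; have := Pz k; rewrite !mxE dotpBr lerBlDr.
exact: (bounded_disjoint_translate (polytope_bounded Pv) (polytope_bounded Pv')).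
Qed.

(** Otherwise every term [w i * (f i - S)] is nonnegative while their sum is zero; all weights would
    then vanish. *)
Lemma average_attains_le (I : finType) (w f : I -> R) :
  (forall i, 0 <= w i) -> \sum_i w i = 1 ->
  exists2 i, 0 < w i & f i <= \sum_j w j * f j.
Proof.
move=> w0 w1; apply: contrapT => nle; set S := \sum_j _ in nle.
have gtS i : 0 < w i -> S < f i.
  by move=> wi; rewrite ltNge; apply/negP => fi; apply: nle; exists i.
have : \sum_i w i * (f i - S) = 0.
  under eq_bigr do rewrite mulrBr.
  by rewrite sumrB -mulr_suml w1 mul1r subrr.
move=> /psumr_eq0P wS0.
have wz i : w i = 0.
  have := w0 i; rewrite le_eqVlt => /predU1P[//|wi].
  have /eqP : w i * (f i - S) = 0.
    apply: wS0 => // j _; have := w0 j; rewrite le_eqVlt => /predU1P[<-|wj].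
      by rewrite mul0r.
    by rewrite mulr_ge0 // subr_ge0 ltW // gtS.
  by rewrite mulf_eq0 subr_eq0 (gt_eqF (gtS i wi)) orbF => /eqP.
by move: w1; rewrite big1 // => /eqP; rewrite eq_sym oner_eq0.
Qed.

(* The vertices of positive weight in a convex combination equal to [z] all lie
   on the supporting line [dotp a = c]. *)
Lemma face_vertex r (v : 'I_r -> 'rV[R]_2) a d c z : conv_hull v z ->
  (forall l, c <= dotp a (v l)) -> dotp a z <= c ->
  exists2 l, dotp a (v l) = c & dotp d (v l) <= dotp d z.
Proof.
move=> [w [w0 w1 ->]] cv; rewrite !dotp_sumr => zc.
have [l wl dl] := average_attains_le (fun l => dotp d (v l)) w0 w1.
exists l => //; apply/eqP; rewrite eq_le cv andbT leNgt; apply/negP => al.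
have: \sum_i w i * (dotp a (v i) - c) <= 0.
  under eq_bigr do rewrite mulrBr.
  by rewrite sumrB -mulr_suml w1 mul1r subr_le0.
rewrite leNgt (bigD1 l) //= => /negP; apply; apply: ltr_wpDr.
  by apply: sumr_ge0 => i _; rewrite mulr_ge0 // subr_ge0.
by rewrite mulr_gt0 // subr_gt0.
Qed.

(** A quarter turn: for a unit normal [a], it is the direction of the edge line and completes [a] to
    an orthonormal frame. *)
Definition rot a : 'rV[R]_2 := \row_j (if j == ord0 then - a 0 1 else a 0 0).

Lemma dotp_rot_eq a p q : dotp a a = 1 ->
  dotp a p = dotp a q -> dotp (rot a) p = dotp (rot a) q -> p = q.
Proof.
move=> a1 /eqP; rewrite -subr_eq0 -dotpBr => /eqP aw /eqP.
rewrite -subr_eq0 -dotpBr => /eqP tw; apply/subr0_eq; move: aw tw.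
move: (p - q) a1 => w; rewrite /dotp !big_ord_recl !big_ord0 !addr0 !mxE /=.
have -> : lift ord0 (ord0 : 'I_1) = 1 :> 'I_2 by apply/val_inj.
have -> : ord0 = 0 :> 'I_2 by apply/val_inj.
set x := a 0 0; set y := a 0 1 => xy1 aw tw.
(* Expansion of [w] in the orthonormal frame [a], [rot a]. *)
have w0 : w 0 0 = x * (x * w 0 0 + y * w 0 1) - y * (- y * w 0 0 + x * w 0 1).
  by rewrite -[LHS]mul1r -xy1; ring.
have w1 : w 0 1 = y * (x * w 0 0 + y * w 0 1) + x * (- y * w 0 0 + x * w 0 1).
  by rewrite -[LHS]mul1r -xy1; ring.
apply/rowP => j; rewrite mxE; have [->|->] : j = 0 \/ j = 1.
- by case: j => [[|[|j]] hj]; [left; apply/val_inj|right; apply/val_inj|].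
- by rewrite w0 aw tw !mulr0 subr0.
- by rewrite w1 aw tw !mulr0 addr0.
Qed.

Lemma polyhedron_segment r (A : 'M[R]_(r, 2)) b p z l : 0 <= l <= 1 ->
  polyhedron A b p -> polyhedron A b z ->
  polyhedron A b (l *: p + (1 - l) *: z).
Proof.
move=> /andP[l0 l1] Pp Pz k; rewrite dotpDr !dotpZr.
by have := Pp k; have := Pz k; nra.
Qed.

Lemma polyhedron_between r (A : 'M[R]_(r, 2)) b a p z q :
  polyhedron A b p -> polyhedron A b z -> dotp a a = 1 ->
  dotp a p = dotp a z -> dotp a q = dotp a z ->
  dotp (rot a) p <= dotp (rot a) q <= dotp (rot a) z -> polyhedron A b q.
Proof.
move=> Pp Pz a1 ap aq /andP[pq qz].
have [pz|zp] := leP (dotp (rot a) z) (dotp (rot a) p).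
  by rewrite (_ : q = z) //; apply: (dotp_rot_eq a1) => //; lra.
pose l := (dotp (rot a) z - dotp (rot a) q) / (dotp (rot a) z - dotp (rot a) p).
have zp0 : 0 < dotp (rot a) z - dotp (rot a) p by rewrite subr_gt0.
rewrite (_ : q = l *: p + (1 - l) *: z).
  apply: polyhedron_segment => //; apply/andP; split.
    by rewrite divr_ge0 ?(ltW zp0) // subr_ge0.
  by rewrite ler_pdivrMr // mul1r lerD2l lerN2.
apply: (dotp_rot_eq a1); rewrite dotpDr !dotpZr.
  by rewrite ap aq; ring.
by rewrite /l; field; apply: lt0r_neq0.
Qed.

(* The polygons meet inside the line [dotp a = b k 0], where they cut out two
   segments; the lower end of one of them lies in the other. *)
Lemma touching_vertex r s (A : 'M[R]_(r.+1, 2)) b v (A' : 'M[R]_(s.+1, 2)) b' v' :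
  polytope A b v -> polytope A' b' v' -> separates A b v' ->
  (forall k, exists l, dotp (row k A) (v' l) <= b k 0) ->
  (forall k, exists l, dotp (row k A') (v l) <= b' k 0) ->
  (exists l, polyhedron A b (v' l)) \/ (exists l, polyhedron A' b' (v l)).
Proof.
move=> Pv Pv' [k sep] le le'.
have [] := @polyhedra_meet _ _ A b A' b'.
- by exists (v ord0); apply: polytope_vertex.
- by exists (v' ord0); apply: polytope_vertex.
- by move=> i; have [l ?] := le i; exists (v' l) => //; apply: polytope_vertex.
- by move=> i; have [l ?] := le' i; exists (v l) => //; apply: polytope_vertex.
move=> z [Pz Qz]; pose a := row k A.
have a1 : dotp a a = 1 by apply/dotp_enorm/(polytope_unit Pv).
have az : dotp a z = b k 0.
  by apply/eqP; rewrite eq_le (Pz k) (polytope_ge Pv' sep).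
have [l1 al1 dl1] : exists2 l, dotp a (v' l) = b k 0 &
    dotp (rot a) (v' l) <= dotp (rot a) z.
  by apply: face_vertex; rewrite -?(polytope_hull Pv') ?az.
(* The polygon owning the edge lies on the other side of the line, hence the opposite normal. *)
have [l2 al2 dl2] : exists2 l, dotp (- a) (v l) = - b k 0 &
    dotp (rot a) (v l) <= dotp (rot a) z.
  apply: face_vertex => [|l|]; first by rewrite -(polytope_hull Pv).
    by rewrite dotpNl lerN2; apply: polytope_vertex.
  by rewrite dotpNl az.
move: al2; rewrite dotpNl => /oppr_inj al2.
(* Neither vertex is above [z] along the line, so the higher of the two lies between the other one
   and [z]. *)
have [v12|v21] := leP (dotp (rot a) (v l2)) (dotp (rot a) (v' l1)).
  left; exists l1.
  apply: (polyhedron_between (polytope_vertex l2 Pv) Pz a1); rewrite ?az //.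
  exact/andP.
right; exists l2.
apply: (polyhedron_between (polytope_vertex l1 Pv') Qz a1); rewrite ?az //.
by rewrite (ltW v21).
Qed.

Lemma near_polyhedron r (A : 'M[R]_(r, 2)) (b : 'cV[R]_r) (T : Type)
    (F : set_system T) (f : T -> 'rV[R]_2) z : Filter F ->
  f @ F --> z -> (forall k, dotp (row k A) z < b k 0) ->
  \forall t \near F, forall k, dotp (row k A) (f t) < b k 0.
Proof.
move=> FF fz zb; apply: filter_forall => k.
have : dotp (row k A) (f t) @[t --> F] --> dotp (row k A) z.
  by apply: continuous_cvg fz; apply: dotp_continuous.
by move=> /cvgr_lt/(_ _ (zb k)).
Qed.

Lemma cvg_ray m (z d : 'rV[R]_m) : z + t *: d @[t --> (0 : R)^'+] --> z.
Proof.
rewrite -[X in _ --> X]addr0; apply: cvgD; first exact: cvg_cst.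
rewrite -[X in _ --> X](scale0r d); apply: cvgZr_tmp.
exact: cvg_at_right_filter.
Qed.

(** From an interior point, a short step along the normal of any edge stays in the polygon and
    raises the left side of that inequality, which was therefore strict. *)
Lemma polytope_interior_lt r (A : 'M[R]_(r.+1, 2)) b v : polytope A b v ->
  exists z, forall k, dotp (row k A) z < b k 0.
Proof.
move=> Pv; have [z zP] := polytope_interior Pv; exists z => k.
have near_P : \forall t \near (0 : R)^'+, polyhedron A b (z + t *: row k A).
  exact: cvg_ray zP.
have [t [Pt t0]] := filter_ex (filterI near_P (nbhs_right_gt 0)).
have := Pt k; rewrite dotpDr dotpZr (dotp_enorm (polytope_unit Pv k)) mulr1.
lra.
Qed.

(** Moving [q] slightly towards a strictly interior point of the second polygon makes all its edge
    inequalities strict without leaving the first polygon, which excludes separation. *)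
Lemma not_separates_inside r s (A : 'M[R]_(r.+1, 2)) b v
    (A' : 'M[R]_(s.+1, 2)) b' v' q :
  polytope A b v -> polytope A' b' v' ->
  (forall k, dotp (row k A) q < b k 0) -> polyhedron A' b' q ->
  ~ separates A' b' v.
Proof.
move=> Pv Pv' qb Qq [k sep].
have [d dQ] := polytope_interior_lt Pv'.
have /(_ _) near_P := near_polyhedron _ (@cvg_ray 2 q (d - q)) qb.
have [t [[Pt t0] t1]] :=
  filter_ex (filterI (filterI near_P (nbhs_right_gt 0)) (nbhs_right_lt ltr01)).
have /(polytope_ge Pv sep) : polyhedron A b (q + t *: (d - q)).
  by move=> i; apply/ltW/Pt.
rewrite dotpDr dotpZr dotpBr; have := Qq k; have := dQ k.
by move: t0 t1 => /=; nra.
Qed.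

End Polytopes.

(** * Derivatives of the component functions and local Lipschitz bounds *)

Section Calculus.
Context {R : realType}.

Lemma is_diff_entry (V : normedModType R) m n (F dF : V -> 'M[R]_(m, n)) x i j :
  is_diff x F dF -> is_diff x (fun y => F y i j : R) (fun u => dF u i j : R).
Proof.
move=> dFx; have @f : {linear 'M[R]_(m, n) -> R}.
  by exists (fun N : 'M[R]_(_, _) => N i j); do 2![eexists]; do ?[constructor];
     rewrite ?mxE// => ? *; rewrite ?mxE//; move=> ?; rewrite !mxE.
have f_cont : continuous f by apply: coord_continuous.
have dfx : is_diff (F x) f f.
  by apply: DiffDef; [exact: linear_differentiable|rewrite diff_lin].
exact: (is_diff_comp dFx dfx).
Qed.

Lemma dotp_row2 r (M : 'M[R]_(r, 2)) k (w : 'rV[R]_2) :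
  dotp (row k M) w =
  M k ord0 * w 0 ord0 + M k (lift ord0 ord0) * w 0 (lift ord0 ord0).
Proof. by rewrite /dotp !big_ord_recl big_ord0 addr0 !mxE. Qed.

(** The product rule for the expression common to [phi] and [psi], expanded in two coordinates. *)
Lemma is_diff_gap (V : normedModType R) r (F dF : V -> 'M[R]_(r, 2))
    (G dG : V -> 'rV[R]_2) (H dH : V -> 'cV[R]_r) k x :
  is_diff x F dF -> is_diff x G dG -> is_diff x H dH ->
  is_diff x (fun y => dotp (row k (F y)) (G y) - H y k 0)
    (fun u => dotp (row k (dF u)) (G x) + dotp (row k (F x)) (dG u) - dH u k 0).
Proof.
move=> dFx dGx dHx.
have dFj j := is_diff_entry k j dFx; have dGj j := is_diff_entry 0 j dGx.
have dH0 := is_diff_entry k 0 dHx.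
have -> : (fun y => dotp (row k (F y)) (G y) - H y k 0) =
    ((fun y => F y k ord0) * (fun y => G y 0 ord0) +
     (fun y => F y k (lift ord0 ord0)) * (fun y => G y 0 (lift ord0 ord0))
     - (fun y => H y k 0) : V -> R).
  by apply/funext => y; rewrite dotp_row2.
have D := is_diffB (is_diffD (is_diffM (dFj ord0) (dGj ord0))
  (is_diffM (dFj (lift ord0 ord0)) (dGj (lift ord0 ord0)))) dH0.
apply: (is_diff_eq D); apply/funext => u.
rewrite [dotp _ (G x)]dotp_row2 [dotp _ (dG u)]dotp_row2.
transitivity (F x k ord0 * dG u 0 ord0 + G x 0 ord0 * dF u k ord0
  + (F x k (lift ord0 ord0) * dG u 0 (lift ord0 ord0)
     + G x 0 (lift ord0 ord0) * dF u k (lift ord0 ord0)) - dH u k 0) => //.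
congr (_ - _); rewrite addrACA [X in _ = X]addrC; congr (_ + _).
by congr (_ + _); apply: mulrC.
Qed.

Lemma is_diff_comp_linear (V V' W : normedModType R) (f : V' -> W)
    (L : {linear V -> V'}) x : continuous L -> differentiable f (L x) ->
  is_diff x (f \o L) ('d f (L x) \o L).
Proof.
move=> Lc df; apply: is_diff_comp.
  by apply: DiffDef; [exact: linear_differentiable|rewrite diff_lin].
exact: differentiableP.
Qed.

Lemma diffE_is_diff (V W : normedModType R) (f df : V -> W) x u :
  is_diff x f df -> 'd f x u = df u.
Proof. by move=> dfx; rewrite diff_val. Qed.

(** [L] and [M] stand for the two projections of the state in either order, so that one statement
    serves both [phi] and [psi]. *)
Lemma cont_differentiable_gap p q (m := (p + q)%N) r
    (F : 'rV[R]_p -> 'M[R]_(r, 2)) (G : 'rV[R]_q -> 'rV[R]_2)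
    (H : 'rV[R]_p -> 'cV[R]_r) (L : {linear 'rV[R]_m -> 'rV[R]_p})
    (M : {linear 'rV[R]_m -> 'rV[R]_q}) k :
  cont_differentiable F -> cont_differentiable G -> cont_differentiable H ->
  continuous L -> continuous M ->
  cont_differentiable (fun x : 'rV[R]_m =>
    dotp (row k (F (L x))) (G (M x)) - H (L x) k 0).
Proof.
move=> [dF cF] [dG cG] [dH cH] Lc Mc.
have D x := is_diff_gap k (is_diff_comp_linear Lc (dF (L x)))
  (is_diff_comp_linear Mc (dG (M x))) (is_diff_comp_linear Lc (dH (L x))).
split=> [x|u]; first by case: (D x).
have -> : (fun x : 'rV[R]_m => 'd (fun x : 'rV[R]_m =>
      dotp (row k (F (L x))) (G (M x)) - H (L x) k 0) x u) =
  (fun x => dotp (row k ('d F (L x) (L u))) (G (M x))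
     + dotp (row k (F (L x))) ('d G (M x) (M u)) - 'd H (L x) (L u) k 0).
  by apply/funext => x; rewrite (diffE_is_diff _ (D x)).
have entry (T : topologicalType) s t (f : T -> 'M[R]_(s, t)) i j :
    continuous f -> continuous (fun x => f x i j).
  move=> fc x; apply: (@continuous_comp _ _ _ f (fun N => N i j) x (fc x)).
  exact: coord_continuous.
have comp (T U Z : topologicalType) (f : T -> U) (g : U -> Z) :
    continuous f -> continuous g -> continuous (fun x => g (f x)).
  by move=> fc gc x; apply: (@continuous_comp _ _ _ f g x (fc x)); apply: gc.
have dotc (T : topologicalType) (f : T -> 'M[R]_(r, 2)) (g : T -> 'rV[R]_2) :
    continuous f -> continuous g ->
    continuous (fun x => dotp (row k (f x)) (g x)).
  move=> fc gc; apply: continuous_big => [|j _]; first exact: add_continuous.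
  under eq_fun do rewrite mxE.
  by move=> x; apply: (@cvgM _ _ (nbhs x)); apply: entry.
have diffc (V W : normedModType R) (f : V -> W) :
    (forall x, differentiable f x) -> continuous f.
  by move=> df x; apply: differentiable_continuous.
move=> x; apply: (@cvgB _ _ _ (nbhs x)); last first.
  exact: (entry _ _ _ (fun x => 'd H (L x) (L u)) k 0
    (comp _ _ _ L (fun y => 'd H y (L u)) Lc (cH _)) x).
apply: (@cvgD _ _ _ (nbhs x)).
  exact: (dotc _ _ _ (comp _ _ _ L (fun y => 'd F y (L u)) Lc (cF _))
    (comp _ _ _ M G Mc (diffc _ _ _ dG)) x).
exact: (dotc _ _ _ (comp _ _ _ L F Lc (diffc _ _ _ dF))
    (comp _ _ _ M (fun y => 'd G y (M u)) Mc (cG _)) x).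
Qed.

Lemma diff_gradient m (f : 'rV[R]_m -> R) x u :
  differentiable f x -> 'd f x u = dotp (gradient f x) u.
Proof.
move=> df; rewrite {1}(row_sum_delta u) linear_sum; apply: eq_bigr => j _.
by rewrite linearZ /= mxE (deriveE _ df) mulrC.
Qed.

(** The transpose in [jac] turns [row_free] into [row_full] for the action on row vectors, that is,
    into surjectivity of the differential. *)
Lemma jac_surj m p (f : 'rV[R]_m -> 'rV[R]_p) x d :
  row_free (jac f x) -> exists u, 'd f x u = d.
Proof.
move=> Jfree; have Jfull : row_full ('J f x).
  by move: Jfree; rewrite /row_free /row_full mxrank_tr.
have /submxP[u ->] := submx_full d Jfull.
by exists u; rewrite mul_rV_lin1.
Qed.

(** Along a direction that fixes the edge and moves the vertex with velocity equal to the unit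
    normal, the derivative is 1. *)
Lemma gradient_gap_neq0 p q (m := (p + q)%N) r
    (F : 'rV[R]_p -> 'M[R]_(r, 2)) (G : 'rV[R]_q -> 'rV[R]_2)
    (H : 'rV[R]_p -> 'cV[R]_r) (L : {linear 'rV[R]_m -> 'rV[R]_p})
    (M : {linear 'rV[R]_m -> 'rV[R]_q}) k x :
  cont_differentiable F -> cont_differentiable G -> cont_differentiable H ->
  continuous L -> continuous M ->
  (forall w, exists2 u, L u = 0 & M u = w) ->
  enorm (row k (F (L x))) = 1 -> row_free (jac G (M x)) ->
  gradient (fun x : 'rV[R]_m =>
    dotp (row k (F (L x))) (G (M x)) - H (L x) k 0) x != 0.
Proof.
move=> [dF _] [dG _] [dH _] Lc Mc LM F1 Gfree.
have D := is_diff_gap k (is_diff_comp_linear Lc (dF (L x)))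
  (is_diff_comp_linear Mc (dG (M x))) (is_diff_comp_linear Lc (dH (L x))).
have [w dw] := jac_surj (row k (F (L x))) Gfree; have [u Lu Mu] := LM w.
have dN : differentiable (fun x : 'rV[R]_m =>
    dotp (row k (F (L x))) (G (M x)) - H (L x) k 0) x.
  by case: D.
have := diff_gradient u dN.
rewrite (diffE_is_diff _ D) /= Lu Mu dw !linear0 dotp_enorm //.
apply: contra_eqN => /eqP ->; rewrite /dotp big1 ?big1; last 2 first.
- by move=> j _; rewrite mxE mul0r.
- by move=> j _; rewrite !mxE mul0r.
by rewrite mxE add0r subr0 oner_neq0.
Qed.

(** A local Lipschitz bound with an explicit constant, near [(x, x)], so that constants add up and
    neighbourhoods are intersected by filter reasoning. *)
Definition loc_lip m (h : 'rV[R]_m -> R) : Prop := forall x : 'rV[R]_m,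
  exists2 K : R, 0 <= K &
    \forall p \near (x, x), `|h p.1 - h p.2| <= K * `|p.1 - p.2|.

Lemma loc_lip_lipschitz m (h : 'rV[R]_m -> R) : loc_lip h -> locally_lipschitz h.
Proof.
move=> hlip x; have [K _ [[U V] [/= Ux Vx] UVK]] := hlip x.
exists (U `&` V); first exact: (@filterI _ (nbhs x) _ _ _ Ux Vx).
have UVx : (U `&` V) x.
  by split; [exact: (nbhs_singleton Ux)|exact: (nbhs_singleton Vx)].
have PF : ProperFilter (globally ((U `&` V) `*` (U `&` V))).
  by apply: (@globally_properfilter _ _ (x, x)).
apply: (klipschitzW (k := K)) => -[y z] /= [[Uy _] [_ Vz]].
exact: (UVK (y, z)).
Qed.

Lemma loc_lip_continuous m (h : 'rV[R]_m -> R) : loc_lip h -> continuous h.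
Proof.
move=> hlip x; have [K K0 [[U V] [/= Ux Vx] UVK]] := hlip x.
apply/(@cvgrPdist_le _ _ _ (nbhs x)) => e e0; near=> y.
apply: (le_trans (UVK (x, y) _)).
  by split => /=; [exact: nbhs_singleton|near: y].
(* The constant [K] may be 0, whereas [K + 1] can be divided by. *)
apply: (@le_trans _ _ ((K + 1) * `|x - y|)).
  by rewrite ler_wpM2r // lerDl.
rewrite -ler_pdivlMl ?ltr_wpDl // mulrC.
near: y; apply: cvgr_dist_le; first exact: cvg_id.
by rewrite divr_gt0 // ltr_wpDl.
Unshelve. all: by end_near. Qed.

Lemma loc_lip_op m (op : R -> R -> R) (f g : 'rV[R]_m -> R) :
  (forall a b c d, `|op a b - op c d| <= `|a - c| + `|b - d|) ->
  loc_lip f -> loc_lip g -> loc_lip (fun x => op (f x) (g x)).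
Proof.
move=> opP fl gl x; have [K K0 fK] := fl x; have [K' K'0 gK'] := gl x.
exists (K + K'); first exact: addr_ge0.
apply: (@filterS2 _ (nbhs (x, x)) _ _ _ _ _ fK gK') => -[y z] /= {}fK {}gK'.
by rewrite (le_trans (opP _ _ _ _)) // mulrDl lerD.
Qed.

(** The default [f0] varies with [x] because [fmax] and [fmin] start from a value of the family. *)
Lemma loc_lip_big m (op : R -> R -> R) (I : Type) (s : seq I)
    (f0 : 'rV[R]_m -> R) (f : I -> 'rV[R]_m -> R) :
  (forall a b c d, `|op a b - op c d| <= `|a - c| + `|b - d|) ->
  loc_lip f0 -> (forall i, loc_lip (f i)) ->
  loc_lip (fun x => \big[op/f0 x]_(i <- s) f i x).
Proof.
move=> opP l0 lf; elim: s => [|i s IHs].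
  by under [X in loc_lip X]eq_fun do rewrite big_nil.
under [X in loc_lip X]eq_fun do rewrite big_cons.
exact: (loc_lip_op opP (lf i) IHs).
Qed.

Lemma dist_max (a b c d : R) :
  `|Num.max a b - Num.max c d| <= `|a - c| + `|b - d|.
Proof.
have := ler_norm (a - c); have := ler_norm (c - a); rewrite (distrC c).
have := ler_norm (b - d); have := ler_norm (d - b); rewrite (distrC d).
by rewrite ler_norml; case: (leP a b) => ?; case: (leP c d) => ?; lra.
Qed.

Lemma dist_min (a b c d : R) :
  `|Num.min a b - Num.min c d| <= `|a - c| + `|b - d|.
Proof.
have := ler_norm (a - c); have := ler_norm (c - a); rewrite (distrC c).
have := ler_norm (b - d); have := ler_norm (d - b); rewrite (distrC d).
by rewrite ler_norml; case: (leP a b) => ?; case: (leP c d) => ?; lra.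
Qed.

Lemma near_norm_le (T : topologicalType) (g : T -> R) x : continuous g ->
  \forall y \near x, `|g y| <= `|g x| + 1.
Proof.
by move=> gc; apply: cvgr_norm_le; [exact: gc|rewrite ltrDl].
Qed.

Lemma is_derive_line m (f : 'rV[R]_m -> R) x u (t : R) :
  differentiable f (x + t *: u) ->
  is_derive t (1 : R) (fun s : R => f (x + s *: u)) ('d f (x + t *: u) u).
Proof.
move=> df; have D : is_diff t (fun s : R => x + s *: u) (fun s : R => s *: u).
  apply: (is_diff_eq (is_diffD (is_diff_cst x t) (is_diff_scalel t u))).
  by apply/funext => s; rewrite fctE add0r.
have D2 := is_diff_comp D (differentiableP df).
have dN : differentiable (f \o (fun s : R => x + s *: u)) t by case: D2.
apply: DeriveDef; first exact: diff_derivable.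
rewrite (deriveE _ dN) (diffE_is_diff _ D2) /= scale1r //.
Qed.

(** The mean value theorem on a segment, each partial derivative being bounded near [x] by its size
    at [x] plus 1. *)
Lemma cont_differentiable_loc_lip m (f : 'rV[R]_m -> R) :
  cont_differentiable f -> loc_lip f.
Proof.
move=> [df cf] x.
pose K := \sum_(j < m) (`|'d f x (delta_mx 0 j)| + 1).
exists K; first by apply: sumr_ge0 => j _; rewrite addr_ge0.
have [e /= e0 eP] : exists2 e : R, 0 < e & forall y, ball x e y -> forall j : 'I_m,
    `|'d f y (delta_mx 0 j)| <= `|'d f x (delta_mx 0 j)| + 1.
  apply/nbhs_ballP; apply: (@filter_forall _ _ _ (nbhs x)) => j.
  exact: near_norm_le (cf (delta_mx 0 j)).
exists (ball x e, ball x e); first by split; apply: nbhsx_ballx.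
move=> [y z] /= [xy xz].
have bound (c u : 'rV[R]_m) : ball x e c -> `|'d f c u| <= K * `|u|.
  move=> /eP cP; rewrite (diff_gradient u (df c)) mulr_suml.
  apply: (le_trans (ler_norm_sum _ _ _)); apply: ler_sum => j _.
  rewrite normrM; apply: ler_pM => //.
    by rewrite mxE (deriveE _ (df c)).
  by rewrite [leRHS]/Num.norm /= mx_normrE; apply: (le_bigmax _ _ (0, j)).
pose g (t : R) := f (z + t *: (y - z)).
have [|c] := @MVT_segment _ g (fun t => 'd f (z + t *: (y - z)) (y - z)) _ _ ler01
    (fun t _ => @is_derive_line m f z (y - z) t (df _)).
  apply: derivable_within_continuous => t _.
  by have [] := @is_derive_line m f z (y - z) t (df _).
rewrite in_itv /= => /andP[c0 c1].
rewrite /g scale0r scale1r addr0 subr0 mulr1 (addrC z (y - z)) subrK => ->.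
apply: bound; move: xy xz; rewrite -ball_normE /= => xy xz.
(* The intermediate point is a convex combination of [y] and [z], so it stays in the ball where the
   bound holds. *)
have -> : x - (z + c *: (y - z)) = (1 - c) *: (x - z) + c *: (x - y).
  by apply/rowP => j; rewrite !mxE; ring.
apply: (le_lt_trans (ler_normD _ _)).
rewrite !normrZ (ger0_norm c0) ger0_norm ?subr_ge0 //.
have [->|c_neq0] := eqVneq c 0; first by rewrite subr0 mul1r mul0r addr0.
have cp : 0 < c by rewrite lt_def c_neq0.
by nra.
Qed.

Lemma cvg_ray_quotient m p (v : 'rV[R]_m -> 'rV[R]_p) x u : differentiable v x ->
  t^-1 *: (v (x + t *: u) - v x) @[t --> (0 : R)^'+] --> 'd v x u.
Proof.
move=> dv; rewrite -(deriveE u dv).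
have -> : (fun t : R => t^-1 *: (v (x + t *: u) - v x)) =
    (fun h : R => h^-1 *: ((v \o shift x) (h *: u) - v x)).
  by apply/funext => t /=; rewrite (addrC x).
by apply: cvg_dnbhs_at_right; apply: diff_derivable.
Qed.
End Calculus.

(** * Comparing finite maxima and minima with a constant *)

Section Extrema.
Context {R : realType} (r : nat).
Implicit Types (f : 'I_r.+1 -> R) (c : R).

Lemma fmax_ltP f c : fmax f < c <-> forall k, f k < c.
Proof.
split=> [/bigmax_ltP[_ fc] k|fc]; first exact: fc.
by apply/bigmax_ltP; split.
Qed.

Lemma fmax_leP f c : fmax f <= c <-> forall k, f k <= c.
Proof.
split=> [/bigmax_leP[_ fc] k|fc]; first exact: fc.
by apply/bigmax_leP; split.
Qed.

Lemma fmin_ltP f c : fmin f < c <-> exists k, f k < c.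
Proof.
split=> [/bigmin_ltP[?|[k _ ?]]|[k fk]]; [by exists ord0|by exists k|].
by apply/bigmin_ltP; right; exists k.
Qed.

Lemma fmin_leP f c : fmin f <= c <-> exists k, f k <= c.
Proof.
split=> [/bigmin_leP[?|[k _ ?]]|[k fk]]; [by exists ord0|by exists k|].
by apply/bigmin_leP; right; exists k.
Qed.

End Extrema.

(** * Sign and regularity of [h_a] on the safe set *)

Section Barrier.
Context {R : realType}.

Lemma loc_lip_fmax m r (f : 'I_r.+1 -> 'rV[R]_m -> R) :
  (forall k, loc_lip (f k)) -> loc_lip (fun x => fmax (f ^~ x)).
Proof.
by move=> lf; apply: (loc_lip_big _ (@dist_max R) (lf ord0)).
Qed.

Lemma loc_lip_fmin m r (f : 'I_r.+1 -> 'rV[R]_m -> R) :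
  (forall k, loc_lip (f k)) -> loc_lip (fun x => fmin (f ^~ x)).
Proof.
by move=> lf; apply: (loc_lip_big _ (@dist_min R) (lf ord0)).
Qed.

Lemma polygon_polytope n r (A : 'rV[R]_n -> 'M[R]_(r.+1, 2)) b v x :
  polygon_assumptions A b v -> polytope (A x) (b x) (v ^~ x).
Proof.
by case=> hull _ _ _ bounded inner _ _ _ unit _ _; split.
Qed.

(** The direction [u] gives the vertex a velocity pointing to a strictly interior point [c] of the
    fixed polygon. Once strictly inside, the vertex excludes separation by an edge of either
    polygon. *)
Lemma vertex_enters n r s (A : 'M[R]_(r.+1, 2)) b v
    (A' : 'rV[R]_n -> 'M[R]_(s.+1, 2)) b' v' y l :
  polytope A b v -> polygon_assumptions A' b' v' -> polyhedron A b (v' l y) ->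
  exists u, \forall t \near (0 : R)^'+,
    ~ separates A b (v' ^~ (y + t *: u)) /\
    ~ separates (A' (y + t *: u)) (b' (y + t *: u)) v.
Proof.
move=> Pv H' Pq; have [c cP] := polytope_interior_lt Pv.
have dv' := (polygon_v_C1 H' l).1 y.
have [u du] := jac_surj (c - v' l y) (polygon_v_rank H' l y).
exists u; set q := v' l y in Pq du.
have to_c : t^-1 *: (v' l (y + t *: u) - q) + q @[t --> (0 : R)^'+] --> c.
  rewrite -[X in _ --> X](subrK q) -du; apply: cvgD; last exact: cvg_cst.
  exact: cvg_ray_quotient.
have /(_ _) near_c := near_polyhedron _ to_c cP.
apply: filterS (filterI (filterI near_c (nbhs_right_gt 0)) (nbhs_right_lt ltr01)).
(* The moved vertex is a convex combination of [q] and of a point near [c]. *)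
move=> t [[ct t0] t1]; have inside k : dotp (row k A) (v' l (y + t *: u)) < b k 0.
  have -> : v' l (y + t *: u) =
      t *: (t^-1 *: (v' l (y + t *: u) - q) + q) + (1 - t) *: q.
    rewrite scalerDr scalerA divff ?gt_eqF // scale1r scalerBl scale1r.
    by rewrite addrA addrAC addrK addrNK.
  rewrite dotpDr !dotpZr; have := ct k; have := Pq k.
  by move: t0 t1 => /=; nra.
split; first by apply/separatesPn => k; exists l.
apply: (not_separates_inside Pv (polygon_polytope _ H') inside).
exact: (polytope_vertex _ (polygon_polytope _ H')).
Qed.


Variables (n ri rj : nat).
Variables (Ai : 'rV[R]_n -> 'M[R]_(ri.+1, 2)) (bi : 'rV[R]_n -> 'cV[R]_(ri.+1))
    (vi : 'I_ri.+1 -> 'rV[R]_n -> 'rV[R]_2)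
    (Aj : 'rV[R]_n -> 'M[R]_(rj.+1, 2)) (bj : 'rV[R]_n -> 'cV[R]_(rj.+1))
    (vj : 'I_rj.+1 -> 'rV[R]_n -> 'rV[R]_2).
Hypotheses (Hi : polygon_assumptions Ai bi vi)
  (Hj : polygon_assumptions Aj bj vj).
Local Notation ha := (h_a Ai bi vi Aj bj vj).
Local Notation Safe := (safe_set Ai bi Aj bj).

Lemma h_a_lt0P x : ha x < 0 <->
  ~ separates (Ai (lsubmx x)) (bi (lsubmx x)) (vj ^~ (rsubmx x)) /\
  ~ separates (Aj (rsubmx x)) (bj (rsubmx x)) (vi ^~ (lsubmx x)).
Proof.
rewrite /h_a gt_max; split.
  move=> /andP[/fmax_ltP hi /fmax_ltP hj].
  split; apply/separatesPn => k.
    by have /fmin_ltP[l] := hi k; rewrite subr_lt0; exists l.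
  by have /fmin_ltP[l] := hj k; rewrite subr_lt0; exists l.
move=> [/separatesPn hi /separatesPn hj]; apply/andP.
split; apply/fmax_ltP => k; apply/fmin_ltP.
  by have [l] := hi k; exists l; rewrite subr_lt0.
by have [l] := hj k; exists l; rewrite subr_lt0.
Qed.

Lemma h_a_le0P x : ha x <= 0 <->
  (forall k, exists l, dotp (row k (Ai (lsubmx x))) (vj l (rsubmx x)) <=
    bi (lsubmx x) k 0) /\
  (forall k, exists l, dotp (row k (Aj (rsubmx x))) (vi l (lsubmx x)) <=
    bj (rsubmx x) k 0).
Proof.
rewrite /h_a ge_max; split.
  move=> /andP[/fmax_leP hi /fmax_leP hj]; split=> k.
    by have /fmin_leP[l] := hi k; rewrite subr_le0; exists l.
  by have /fmin_leP[l] := hj k; rewrite subr_le0; exists l.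
move=> [hi hj]; apply/andP.
split; apply/fmax_leP => k; apply/fmin_leP.
  by have [l] := hi k; exists l; rewrite subr_le0.
by have [l] := hj k; exists l; rewrite subr_le0.
Qed.

(** Both sides amount to weak separation by some edge line. *)
Lemma safe_setE x : Safe x <-> 0 <= ha x.
Proof.
rewrite /safe_set /h_s /=.
rewrite (sdist_ge0P (polygon_polytope (lsubmx x) Hi)
  (polygon_polytope (rsubmx x) Hj)).
rewrite leNgt; split.
  by move=> sep; apply/negP => /h_a_lt0P[nsi nsj]; case: sep.
by move=> /negP nlt; apply: contrapT => /not_orP ns; apply/nlt/h_a_lt0P.
Qed.

Lemma phi_C1 k l : cont_differentiable (phi Ai bi vj k l).
Proof.
apply: (@cont_differentiable_gap R n n ri.+1 Ai (vj l) bi lsubmx rsubmx k).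
- exact: (polygon_A_C1 Hi).
- exact: (polygon_v_C1 Hj).
- exact: (polygon_b_C1 Hi).
- exact: continuous_lsubmx.
- exact: continuous_rsubmx.
Qed.

Lemma psi_C1 k l : cont_differentiable (psi vi Aj bj k l).
Proof.
apply: (@cont_differentiable_gap R n n rj.+1 Aj (vi l) bj rsubmx lsubmx k).
- exact: (polygon_A_C1 Hj).
- exact: (polygon_v_C1 Hi).
- exact: (polygon_b_C1 Hj).
- exact: continuous_rsubmx.
- exact: continuous_lsubmx.
Qed.

Lemma gradient_phi_neq0 k l x : gradient (phi Ai bi vj k l) x != 0.
Proof.
apply: (@gradient_gap_neq0 R n n ri.+1 Ai (vj l) bi lsubmx rsubmx k).
- exact: (polygon_A_C1 Hi).
- exact: (polygon_v_C1 Hj).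
- exact: (polygon_b_C1 Hi).
- exact: continuous_lsubmx.
- exact: continuous_rsubmx.
- by move=> w; exists (row_mx 0 w); [exact: row_mxKl|exact: row_mxKr].
- exact: (polygon_unit Hi).
- exact: (polygon_v_rank Hj).
Qed.

Lemma gradient_psi_neq0 k l x : gradient (psi vi Aj bj k l) x != 0.
Proof.
apply: (@gradient_gap_neq0 R n n rj.+1 Aj (vi l) bj rsubmx lsubmx k).
- exact: (polygon_A_C1 Hj).
- exact: (polygon_v_C1 Hi).
- exact: (polygon_b_C1 Hj).
- exact: continuous_rsubmx.
- exact: continuous_lsubmx.
- by move=> w; exists (row_mx w 0); [exact: row_mxKr|exact: row_mxKl].
- exact: (polygon_unit Hj).
- exact: (polygon_v_rank Hi).
Qed.

Lemma h_a_loc_lip : loc_lip ha.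
Proof.
apply: (loc_lip_op (@dist_max R)).
  exact: (loc_lip_fmax (fun k => loc_lip_fmin (fun l =>
    cont_differentiable_loc_lip (phi_C1 k l)))).
exact: (loc_lip_fmax (fun k => loc_lip_fmin (fun l =>
  cont_differentiable_loc_lip (psi_C1 k l)))).
Qed.

(** At a zero some edge separates weakly but none strictly, so a vertex of one polygon lies in the
    other; moving only the polygon of that vertex makes the two overlap. *)
Lemma h_a_neg_near x : ha x = 0 ->
  exists d, \forall t \near (0 : R)^'+, ha (x + t *: d) < 0.
Proof.
move=> hx; have Pi := polygon_polytope (lsubmx x) Hi.
have Pj := polygon_polytope (rsubmx x) Hj.
have /h_a_le0P[lei lej] : ha x <= 0 by rewrite hx.
have sep : separates (Ai (lsubmx x)) (bi (lsubmx x)) (vj ^~ (rsubmx x)) \/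
    separates (Aj (rsubmx x)) (bj (rsubmx x)) (vi ^~ (lsubmx x)).
  by apply: contrapT => /not_orP/h_a_lt0P; rewrite hx ltxx.
have [[l Pl]|[l Ql]] :
    (exists l, polyhedron (Ai (lsubmx x)) (bi (lsubmx x)) (vj l (rsubmx x))) \/
    (exists l, polyhedron (Aj (rsubmx x)) (bj (rsubmx x)) (vi l (lsubmx x))).
  case: sep => sep; first exact: (touching_vertex Pi Pj sep).
  by have [] := touching_vertex Pj Pi sep lej lei; [right|left].
- have [u uP] := vertex_enters Pi Hj Pl.
  exists (row_mx 0 u); apply: filterS uP => t ut; apply/h_a_lt0P.
  by rewrite !linearD /= !linearZ /= row_mxKl row_mxKr scaler0 addr0.
- have [u uP] := vertex_enters Pj Hi Ql.
  exists (row_mx u 0); apply: filterS uP => t [ut1 ut2]; apply/h_a_lt0P.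
  by rewrite !linearD /= !linearZ /= row_mxKl row_mxKr scaler0 addr0.
Qed.

(** At an interior zero, the ray along which [h_a] becomes negative would start inside the safe
    set. *)
Lemma h_a_interior_gt0 x : Safe° x -> 0 < ha x.
Proof.
move=> Sx; have := interior_subset Sx => /safe_setE.
rewrite le_eqVlt => /predU1P[/esym|//].
move=> /h_a_neg_near[d dneg].
have near_S : \forall t \near (0 : R)^'+, Safe (x + t *: d).
  exact: (cvg_ray d Sx).
have [t [tneg /safe_setE]] := filter_ex (filterI dneg near_S).
by rewrite leNgt tneg.
Qed.

Lemma closed_safe_set : closed Safe.
Proof.
have -> : Safe = ha @^-1` [set y | 0 <= y] by apply/seteqP; split=> x /safe_setE.
apply: preimage_closed; last exact: closed_ge.
by move=> x _; apply: loc_lip_continuous h_a_loc_lip _.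
Qed.

Lemma h_a_nbf_conditions : nbf_conditions Safe ha.
Proof.
split.
- exact/loc_lip_lipschitz/h_a_loc_lip.
(* A boundary point belongs to the closed safe set; a positive value there would persist nearby and
   make the point interior. *)
- move=> x [/closed_safe_set/safe_setE]; rewrite le_eqVlt => /predU1P[//|hx] [].
  have := @loc_lip_continuous _ _ _ h_a_loc_lip x.
  move=> /cvgr_gt/(_ _ hx); rewrite /interior.
  by apply: (@filterS _ (nbhs x)) => y hy; apply/safe_setE/ltW.
- exact: h_a_interior_gt0.
- by move=> x /safe_setE/negP; rewrite -ltNge.
Qed.
End Barrier.

Theorem theorem2 (R : realType) (n : nat) (hn : (2 <= n)%N) (ri rj : nat)
    (Ai : 'rV[R]_n -> 'M[R]_(ri.+1, 2)) (bi : 'rV[R]_n -> 'cV[R]_(ri.+1))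
    (vi : 'I_ri.+1 -> 'rV[R]_n -> 'rV[R]_2)
    (Aj : 'rV[R]_n -> 'M[R]_(rj.+1, 2)) (bj : 'rV[R]_n -> 'cV[R]_(rj.+1))
    (vj : 'I_rj.+1 -> 'rV[R]_n -> 'rV[R]_2)
    (Hi : polygon_assumptions Ai bi vi) (Hj : polygon_assumptions Aj bj vj) :
  let Safe := safe_set Ai bi Aj bj in
  let ha := h_a Ai bi vi Aj bj vj in
  ((forall (ki : 'I_ri.+1) (lj : 'I_rj.+1),
      cont_differentiable (phi Ai bi vj ki lj) /\
      forall x, gradient (phi Ai bi vj ki lj) x != 0) /\
   (forall (kj : 'I_rj.+1) (li : 'I_ri.+1),
      cont_differentiable (psi vi Aj bj kj li) /\
      forall x, gradient (psi vi Aj bj kj li) x != 0)) /\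
  [/\ closed Safe,
      nbf_conditions Safe ha &
      Safe !=set0 -> isolated Safe = set0 -> nbf_candidate Safe ha].
Proof.
move=> Safe ha; split.
  split=> k l; split.
  - exact: (phi_C1 Hi Hj).
  - exact: (gradient_phi_neq0 Hi Hj).
  - exact: (psi_C1 Hi Hj).
  - exact: (gradient_psi_neq0 Hi Hj).
have closedS := closed_safe_set Hi Hj.
have nbf := h_a_nbf_conditions Hi Hj.
by split=> // nonempty noisolated; split.
Qed.
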